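(* Let $\mathcal{R}$ be a noiseless NIP expansion of $(\mathbb{R},<,+,1)$. Then $\mathcal{R}$ has definable choice, that is: for every $A\subseteq \mathbb{R}^{m}\times \mathbb{R}^n$ that is $\emptyset$-definable in $\mathcal{R}$ there is an $\emptyset$-definable function $f: \pi(A) \to \mathbb{R}^n$ such that (1) $\operatorname{gr}(f)\subseteq A$, (2) $f(a) = f(b)$ whenever $a,b\in \pi(A)$ and $A_a=A_b$, where $\pi : \mathbb{R}^{m+n} \to \mathbb{R}^m$ is the projection onto the first $m$ coordinates.
   Context: An expansion of $(\mathbb{R},<)$ is noiseless if it does not define (with parameters) a subset $X\subseteq\mathbb{R}$ that is somewhere dense and co-dense, i.e. such that for some open interval $I$, $X\cap I$ is dense and co-dense in $I$. For $A\subseteq\mathbb{R}^m\times\mathbb{R}^n$ and $a\in\mathbb{R}^m$, $A_a=\{y\in\mathbb{R}^n:(a,y)\in A\}$; $\operatorname{gr}(f)$ is the graph of $f$. *)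

(* Defs.v *)
From mathcomp Require Import all_boot all_order all_algebra.
From mathcomp Require Import all_classical all_reals all_analysis.

Set Implicit Arguments.
Unset Strict Implicit.
Unset Printing Implicit Defensive.

Import Order.TTheory GRing.Theory Num.Theory.
Import numFieldNormedType.Exports.

Local Open Scope classical_set_scope.
Local Open Scope ring_scope.

(* Symbols are indexed by their arity; constants are 0-ary functions. *)
Record language := Language {
  fsym : nat -> Type;
  rsym : nat -> Type }.

Record structure (L : language) (M : Type) := Structure {
  fint : forall k, fsym L k -> k.-tuple M -> M;
  rint : forall k, rsym L k -> k.-tuple M -> Prop }.

Inductive term (L : language) (n : nat) : Type :=
| Var of 'I_n
| Fun k of fsym L k & ('I_k -> term L n).

(* [formula L n]: formulas with free variables among x_0, ..., x_(n-1).
   [Ex] binds the variable 0 of its body and shifts the other ones. *)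
Inductive formula (L : language) : nat -> Type :=
| Eq n of term L n & term L n : formula L n
| Rel n k of rsym L k & ('I_k -> term L n) : formula L n
| Not n of formula L n : formula L n
| And n of formula L n & formula L n : formula L n
| Ex n of formula L n.+1 : formula L n.

Fixpoint eval (L : language) (M : Type) (S : structure L M) (n : nat)
    (v : n.-tuple M) (t : term L n) : M :=
  match t with
  | Var i => tnth v i
  | Fun k f args => fint S f [tuple eval S v (args i) | i < k]
  end.

Fixpoint sat (L : language) (M : Type) (S : structure L M) (n : nat)
    (phi : formula L n) : n.-tuple M -> Prop :=
  match phi in formula _ n return n.-tuple M -> Prop with
  | Eq _ t u => fun v => eval S v t = eval S v u
  | Rel _ k r args => fun v => rint S r [tuple eval S v (args i) | i < k]
  | Not _ psi => fun v => ~ sat S psi v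
  | And _ psi chi => fun v => sat S psi v /\ sat S chi v
  | Ex _ psi => fun v => exists x : M, sat S psi (cons_tuple x v)
  end.

Definition expands (M : Type) (L0 L : language)
    (S0 : structure L0 M) (S : structure L M) : Prop :=
  exists (fi : forall k, fsym L0 k -> fsym L k)
         (ri : forall k, rsym L0 k -> rsym L k),
    (forall k (f : fsym L0 k) (v : k.-tuple M),
        fint S (fi k f) v = fint S0 f v) /\
    (forall k (r : rsym L0 k) (v : k.-tuple M),
        rint S (ri k r) v <-> rint S0 r v).

(* The suffix 0 means: without parameters; [definable] allows parameters [c]. *)
Definition definable0 (L : language) (M : Type) (S : structure L M) (n : nat)
    (X : set (n.-tuple M)) : Prop :=
  exists phi : formula L n, X = [set x | sat S phi x].

Definition definable (L : language) (M : Type) (S : structure L M) (n : nat)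
    (X : set (n.-tuple M)) : Prop :=
  exists (k : nat) (c : k.-tuple M) (phi : formula L (k + n)),
    X = [set x | sat S phi (cat_tuple c x)].

(* M^m x M^n is identified with M^(m+n) by concatenation. *)
Definition prod_set (M : Type) (m n : nat) (A : set (m.-tuple M * n.-tuple M)) :
    set ((m + n).-tuple M) :=
  [set cat_tuple p.1 p.2 | p in A].

(* A function D -> M^n is represented by a total function, whose values
   outside of D are irrelevant. *)
Definition graph_on (M : Type) (m n : nat) (D : set (m.-tuple M))
    (f : m.-tuple M -> n.-tuple M) : set (m.-tuple M * n.-tuple M) :=
  [set p | D p.1 /\ p.2 = f p.1].

Definition definable0_fun (L : language) (M : Type) (S : structure L M)
    (m n : nat) (D : set (m.-tuple M)) (f : m.-tuple M -> n.-tuple M) : Prop :=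
  definable0 S (prod_set (graph_on D f)).

(* phi(x; y) with |x| = m, |y| = n shatters finite sets of every size; by
   compactness this is equivalent to shattering an infinite set in some
   elementary extension. *)
Definition has_IP (L : language) (M : Type) (S : structure L M) (m n : nat)
    (phi : formula L (m + n)) : Prop :=
  forall d : nat,
    exists (a : 'I_d -> m.-tuple M) (b : {set 'I_d} -> n.-tuple M),
      forall (i : 'I_d) (I : {set 'I_d}),
        sat S phi (cat_tuple (a i) (b I)) <-> i \in I.

Definition NIP (L : language) (M : Type) (S : structure L M) : Prop :=
  forall (m n : nat) (phi : formula L (m + n)), ~ has_IP S phi.

Inductive og_fsym : nat -> Type :=
| og_add : og_fsym 2
| og_one : og_fsym 0.

Inductive og_rsym : nat -> Type :=
| og_lt : og_rsym 2.

Definition og_language : language := Language og_fsym og_rsym.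

Definition real_og (R : realType) : structure og_language R :=
  @Structure og_language R
    (fun k (f : og_fsym k) =>
       match f in og_fsym k return k.-tuple R -> R with
       | og_add => fun v => tnth v ord0 + tnth v ord_max
       | og_one => fun _ => 1
       end)
    (fun k (r : og_rsym k) =>
       match r in og_rsym k return k.-tuple R -> Prop with
       | og_lt => fun v => tnth v ord0 < tnth v ord_max
       end).

Definition somewhere_dense_codense (R : realType) (X : set R) : Prop :=
  exists a b : R, a < b /\
    (`]a, b[ `<=` closure (X `&` `]a, b[)) /\
    (`]a, b[ `<=` closure (`]a, b[ `\` X)).

Definition noiseless (R : realType) (L : language) (S : structure L R) : Prop :=
  ~ exists X : set R,
      definable S [set v : 1.-tuple R | X (tnth v ord0)] /\
      somewhere_dense_codense X.

(* Main.v *)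
(* Call a subset X of the line "regular" if it is nonempty and has interior or
   an isolated point.  A regular X has a canonical point: at half the largest
   possible scale s, the points whose s-neighbourhood lies in X (if X has
   interior), resp. contains no other point of X, form a nonempty closed set,
   and one takes its least element >= 1, or else its largest element.  This is
   first-order in X over (<, +, 1), so it yields definable choice in R, and in
   R^n coordinate by coordinate, once every nonempty definable X is regular.

   If X is not, noiselessness makes X nowhere dense, so its closure C is a
   definable closed set with no interior and no isolated point.  Then the
   formula "there is a gap (p, q) of C of length >= eps, with q <= x, and no
   gap of C of length >= delta lies between p and x" has the independence
   property: walking down the tree of pieces of C cut out by longer and longer
   lists of gaps, one may choose at each scale to stay at the left end of the
   current piece or to jump over one of the shorter gaps inside it. *)

Require Import Defs.
From mathcomp Require Import all_boot all_order all_algebra.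
From mathcomp Require Import all_classical all_reals all_analysis.
From mathcomp Require Import lra.

Set Implicit Arguments.
Unset Strict Implicit.
Unset Printing Implicit Defensive.

Import Order.TTheory GRing.Theory Num.Theory.

Local Open Scope classical_set_scope.
Local Open Scope ring_scope.

(** * Gaps of a closed set *)

(** Serves both for lists of scales, newest first, and for environments whose entry 0 is the
    variable bound by [Ex]. *)
Definition scons (T : Type) (x : T) (e : nat -> T) : nat -> T :=
  fun i => if i is j.+1 then e j else x.

Section Gaps.
Context {R : realType}.
Implicit Types (C : set R) (x y z p q d eps : R).

Definition gap C p q :=
  p < q /\ C p /\ C q /\ ~ exists z, C z /\ p < z /\ z < q.

Definition nogap C d x y :=
  ~ exists p q, gap C p q /\ x <= p /\ q <= y /\ p + d <= q.

Definition gap_between C d eps x :=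
  exists p q, gap C p q /\ p + eps <= q /\ q <= x /\ nogap C d p x.

Definition dense_in_itself C :=
  forall x a b, C x -> a < x -> x < b ->
    exists z, C z /\ z <> x /\ a < z /\ z < b.

Definition limit_closed C :=
  forall x, (forall a b, a < x -> x < b -> exists z, C z /\ a < z /\ z < b) ->
    C x.

Definition empty_interior C :=
  forall a b, a < b -> exists z, ~ C z /\ a < z /\ z < b.

Lemma closed_min C a : limit_closed C -> (exists x, C x /\ a <= x) ->
  exists m, C m /\ a <= m /\ forall x, C x -> a <= x -> m <= x.
Proof.
move=> Ccl [x0 [Cx0 ax0]].
pose A := [set x | C x /\ a <= x].
have hA : has_inf A by split; [exists x0 | exists a => x []].
have lbA : lbound A (inf A) by apply: ge_inf hA.2.
have am : a <= inf A by apply: lb_le_inf; [exists x0 | move=> x []].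
exists (inf A); split; last by split=> // x Cx ax; apply: lbA.
apply: Ccl => u v um mv.
have e0 : 0 < v - inf A by lra.
have [y [Cy ay] yv] := inf_adherent e0 hA.
exists y; split=> //; have := lbA y (conj Cy ay); lra.
Qed.

Lemma closed_max C b : limit_closed C -> (exists x, C x /\ x <= b) ->
  exists m, C m /\ m <= b /\ forall x, C x -> x <= b -> x <= m.
Proof.
move=> Ccl [x0 [Cx0 x0b]].
have NCcl : limit_closed [set x | C (- x)].
  move=> x xcl; apply: Ccl => u v ux xv.
  have [||z [Cz [uz zv]]] := xcl (- v) (- u); [lra|lra|].
  by exists (- z); split=> //; split; lra.
have [|m [Cm [bm mmin]]] := @closed_min _ (- b) NCcl.
  by exists (- x0); rewrite /= opprK; split=> //; lra.
exists (- m); split=> //; split; first lra.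
move=> x Cx xb; have : m <= - x by apply: mmin; rewrite /= ?opprK //; lra.
lra.
Qed.

(** Around a point [w] outside [C], the last point of [C] before [w] and the first one after it
    bound a gap. *)
Lemma gap_exists C x y : limit_closed C -> empty_interior C ->
  C x -> C y -> x < y -> exists p q, gap C p q /\ x <= p /\ q <= y.
Proof.
move=> Ccl Cint Cx Cy xy.
have [w [nCw [xw wy]]] := Cint _ _ xy.
have [|p [Cp [pw pmax]]] := @closed_max _ w Ccl.
  by exists x; split=> //; lra.
have [|q [Cq [wq qmin]]] := @closed_min _ w Ccl.
  by exists y; split=> //; lra.
have pw' : p < w.
  by rewrite lt_neqAle pw andbT; apply/eqP => E; apply: nCw; rewrite -E.
have wq' : w < q.
  by rewrite lt_neqAle wq andbT; apply/eqP => E; apply: nCw; rewrite E.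
exists p, q; split; last by split; [apply: pmax | apply: qmin] => //; lra.
split; first lra; split=> //; split=> // -[z [Cz [pz zq]]].
have [zw|wz] := lerP z w.
  have := pmax z Cz zw; lra.
by have := qmin z Cz (ltW wz); lra.
Qed.

(** The gap [(p, c)] keeps [C] away from the left of [c], so [C] accumulates at [c] from the right,
    where [gap_exists] applies. *)
Lemma gap_right C p c eta : limit_closed C -> empty_interior C ->
  dense_in_itself C ->
  gap C p c -> 0 < eta -> exists p' q', gap C p' q' /\ c <= p' /\ q' < c + eta.
Proof.
move=> Ccl Cint Cacc [pc [Cp [Cc pcE]]] eta0.
have [|z [Cz [zc [pz zc']]]] := Cacc c p (c + eta) Cc pc; first lra.
have cz : c < z.
  rewrite ltNge le_eqVlt; apply/negP => /orP[/eqP//|zc1].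
  by apply: pcE; exists z.
have [p' [q' [g [cp q'z]]]] := gap_exists Ccl Cint Cc Cz cz.
by exists p', q'; split=> //; split=> //; lra.
Qed.

Lemma gap_le C p q x : gap C p q -> C x -> x < q -> x <= p.
Proof.
move=> [_ [_ [_ g]]] Cx xq; rewrite leNgt; apply/negP => px.
by apply: g; exists x.
Qed.

Lemma gap_ge C p q x : gap C p q -> C x -> p < x -> q <= x.
Proof.
move=> [_ [_ [_ g]]] Cx px; rewrite leNgt; apply/negP => xq.
by apply: g; exists x.
Qed.

Lemma nogap_trans C d x y z : C y ->
  nogap C d x y -> nogap C d y z -> nogap C d x z.
Proof.
move=> Cy xy yz [p [q [g [xp [qz pq]]]]].
have [yp|py] := lerP y p; first by apply: yz; exists p, q.
have qy := gap_ge g Cy py.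
by apply: xy; exists p, q.
Qed.

Lemma nogap_le C d d' x y : d <= d' -> nogap C d x y -> nogap C d' x y.
Proof.
move=> dd' ng [p [q [g [xp [qy pq]]]]]; apply: ng; exists p, q.
by do 3!split=> //; lra.
Qed.

Lemma pos_lower_bound (T : finType) (F : T -> R) :
  (forall t, 0 < F t) -> exists eps, 0 < eps /\ forall t, eps <= F t.
Proof.
move=> F0; exists (\big[Order.min/1]_t F t); split.
  by elim/big_ind: _ => // x y x0 y0; rewrite lt_min x0.
by move=> t; rewrite (bigD1 t) //= ge_min lexx.
Qed.

(* Shattering tree: the points [c t] are right endpoints of gaps of length at
   least [d 0], and the bits of [t] are read off, most recent first, at the
   scales [d], on the whole piece of [C] that follows [c t] without crossing a
   gap of length at least [d 0]. *)
Lemma gap_tree C k : limit_closed C -> empty_interior C -> dense_in_itself C ->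
  C !=set0 ->
  exists (d : nat -> R) (c : k.-tuple bool -> R), 0 < d 0%N /\
    (forall t, exists p, gap C p (c t) /\ p + d 0%N <= c t) /\
    (forall t (i : 'I_k) x, c t <= x -> nogap C (d 0%N) (c t) x ->
       gap_between C (d i.+1) (d i) x <-> tnth t i).
Proof.
move=> Ccl Cint Cacc [x Cx]; elim: k => [|k [d [c [d0 [cgap cbit]]]]].
  have [||y [Cy [yx _]]] := Cacc x (x - 1) (x + 1) Cx; [lra|lra|].
  have [p [q [g _]]] : exists p q, gap C p q /\ True.
    have [xy|yx'] := ltrP x y.
      by have [p [q [g _]]] := gap_exists Ccl Cint Cx Cy xy; exists p, q.
    have {}yx : y < x by rewrite lt_neqAle yx' andbT; apply/eqP.
    by have [p [q [g _]]] := gap_exists Ccl Cint Cy Cx yx; exists p, q.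
  exists (fun=> q - p), (fun=> q); split; first by case: g => ?; lra.
  by split=> [_|_ []//]; exists p; split=> //; lra.
(* Shortly after each [c t] lies a gap shorter than the newest scale [d 0]; jumping over it or not
   encodes the new bit. *)
have /(_ _)/cid2 gnext t : exists2 pq : R * R, gap C pq.1 pq.2 &
    c t <= pq.1 /\ pq.2 < c t + d 0%N.
  have [p [g _]] := cgap t.
  by have [p' [q' [g' h]]] := gap_right Ccl Cint Cacc g d0; exists (p', q').
pose P t := (s2val (gnext t)).1; pose Q t := (s2val (gnext t)).2.
have gPQ t : gap C (P t) (Q t) by exact: (s2valP (gnext t)).
have cP t : c t <= P t by exact: (s2valP' (gnext t)).1.
have Qc t : Q t < c t + d 0%N by exact: (s2valP' (gnext t)).2.
(* There are finitely many [t], so one scale [eps] serves all these gaps. *)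
have [|eps [eps0 epsPQ]] := @pos_lower_bound _ (fun t => Q t - P t).
  by move=> t; case: (gPQ t) => ? _; lra.
have epsd : eps < d 0%N.
  have t0 : k.-tuple bool by exact: [tuple of nseq k true].
  by move: (epsPQ t0) (cP t0) (Qc t0); lra.
have Cc t : C (c t) by have [p [[_ [_ []]]]] := cgap t.
exists (scons eps d), (fun t => if thead t then Q (behead_tuple t)
                                else c (behead_tuple t)).
split=> //; split=> [t|t i x0 /=].
  case: ifP => _.
    exists (P (behead_tuple t)); split=> //=.
    by move: (epsPQ (behead_tuple t)); lra.
  by have [p [g h]] := cgap (behead_tuple t); exists p; split=> //=; lra.
case/tupleP: t => b t; rewrite theadE.
have -> : behead_tuple [tuple of b :: t] = t by apply: val_inj.
move=> cx ngx.
have ctx : c t <= x0.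
  by move: cx; case: b ngx => //= _; move: (cP t); case: (gPQ t) => ? _; lra.
(* The new piece lies in the old one: the stretch from [c t] to [Q t] is shorter than [d 0], so no
   long gap fits in it. *)
have ngx' : nogap C (d 0%N) (c t) x0.
  have ngx1 := nogap_le (ltW epsd) ngx.
  case: b cx ngx ngx1 => // cx ngx ngx1.
  apply: nogap_trans ngx1; first by case: (gPQ t) => _ [_ []].
  by move=> [p [q [_ [cp [qQ pq]]]]]; move: (Qc t); lra.
have [j ->|->] := unliftP ord0 i.
  by rewrite tnthS; exact: cbit.
(* Bit true: [(P t, Q t)] is the witness. Bit false: a witness starting at or after [c t] has length
   at least [eps], which the piece forbids; one starting earlier is separated from [x0] by the long
   gap ending at [c t]. *)
rewrite tnth0 /=; case: b cx ngx => /= cx ngx.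
  split=> // _; exists (P t), (Q t); split=> //; split.
    by move: (epsPQ t); lra.
  split=> // -[p [q [g [Pp h]]]]; apply: ngx'; exists p, q; split=> //.
  by split=> //; move: (cP t); lra.
split=> // -[p [q [g [pq [qx ng]]]]].
have [cp|pc] := lerP (c t) p; first by case: ngx; exists p, q.
have [p0 [g0 h0]] := cgap t.
have pp0 : p <= p0 by apply: gap_le g0 _ pc; case: g => _ [].
by case: ng; exists p0, (c t).
Qed.

Lemma gap_shatter C k : limit_closed C -> empty_interior C ->
  dense_in_itself C ->
  C !=set0 ->
  exists (d : nat -> R) (c : {set 'I_k} -> R),
    forall (i : 'I_k) I, gap_between C (d i.+1) (d i) (c I) <-> i \in I.
Proof.
move=> Ccl Cint Cacc C0.
have [d [c [d0 [_ cbit]]]] := gap_tree k Ccl Cint Cacc C0.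
exists d, (fun I : {set 'I_k} => c [tuple i \in I | i < k]) => i I.
rewrite -[i \in I](tnth_mktuple (fun j : 'I_k => j \in I)).
(* Each piece is evaluated at its initial point; no gap fits between a point and itself. *)
apply: cbit => // -[p [q [[pq _] [cp [qc _]]]]]; lra.
Qed.

End Gaps.

(** * A canonical point of a regular set *)

Section Selection.
Context {R : realType}.
Implicit Types (X : set R) (a b x y z r s t : R).

Definition has_interior X :=
  exists a b, a < b /\ forall z, a < z -> z < b -> X z.

Definition isolated X r x :=
  X x /\ forall z, X z -> x < z + r -> z < x + r -> z = x.

Definition regular X := X !=set0 /\
  (has_interior X \/ exists x r, 0 < r /\ isolated X r x).

(* If [X] has interior, the points deep inside [X]; otherwise the points of [X]
   far from the others.  Either way they form a closed set when [0 < r]. *)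
Definition deep X r x :=
  has_interior X /\ (forall z, x < z + r -> z < x + r -> X z) \/
  ~ has_interior X /\ isolated X r x.

(** [s + s] is the least upper bound of the scales in [(0, 1]] having a deep point. Doubling avoids
    division, and the cap 1 keeps the supremum finite. *)
Definition half_depth X s :=
  (forall r x, 0 < r -> r <= 1 -> deep X r x -> r <= s + s) /\
  forall t, (forall r x, 0 < r -> r <= 1 -> deep X r x -> r <= t) -> s + s <= t.

(** A nonempty closed set either meets [[1, +oo[], and has a least element there, or is bounded
    above by 1 and has a largest element. *)
Definition chosen X y := exists s, half_depth X s /\ deep X s y /\
  (1 <= y /\ (forall z, deep X s z -> 1 <= z -> y <= z) \/
   y < 1 /\ (forall z, deep X s z -> z < 1 /\ z <= y)).

(** Depends on the set alone, so equal fibres get equal values; 0 is the default when no point is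
    chosen. *)
Definition choose_pt X : R := xget 0 (chosen X).

Lemma deep_le X r r' x : r' <= r -> deep X r x -> deep X r' x.
Proof.
move=> rr' [[iX h]|[iX [Xx h]]]; [left|right]; split=> //.
  by move=> z ? ?; apply: h; lra.
by split=> // z Xz ? ?; apply: h => //; lra.
Qed.

Lemma deep_mem X r x : 0 < r -> deep X r x -> X x.
Proof. by move=> r0 [[_ h]|[_ []] //]; apply: h; lra. Qed.

Lemma deep_exists X : regular X ->
  exists r x, 0 < r /\ r <= 1 /\ deep X r x.
Proof.
move=> [_ reg]; have [iX|niX] := pselect (has_interior X).
  have [a [b [ab h]]] := iX.
  exists (Num.min 1 ((b - a) / 2)), ((a + b) / 2).
  split; first by rewrite lt_min ltr01 /=; lra.
  split; first by rewrite ge_min lexx.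
  apply: (@deep_le X ((b - a) / 2)); first by rewrite ge_min lexx orbT.
  by left; split=> // z ? ?; apply: h; lra.
case: reg => // -[x [r [r0 Xx]]]; exists (Num.min 1 r), x.
split; first by rewrite lt_min ltr01.
split; first by rewrite ge_min lexx.
by apply: (@deep_le X r); [rewrite ge_min lexx orbT|right].
Qed.

(** With interior, any [z] within [s] of the limit is within [s] of a nearby deep point. Without,
    distinct deep points are at least [s] apart, so a limit of deep points is one of them. *)
Lemma deep_closed X s : 0 < s -> limit_closed [set x | deep X s x].
Proof.
move=> s0 x xcl; have [iX|niX] := pselect (has_interior X).
  left; split=> // z xz zx.
  have [||y [[[_ h]|[]//] [? ?]]] := xcl (z - s) (z + s); [lra|lra|].
  by apply: h; lra.
have [||y [Dy [xy yx]]] := xcl (x - s / 2) (x + s / 2); [lra|lra|].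
suff <- : y = x by [].
case: (Dy) => [[]//|[_ [Xy h]]].
apply/eqP; case: ltgtP => // yx'.
  have [||z [Dz [? ?]]] := xcl y (x + s / 2); [lra|lra|].
  suff : z = y by lra.
  by apply: h (deep_mem s0 Dz) _ _; lra.
have [||z [Dz [? ?]]] := xcl (x - s / 2) y; [lra|lra|].
suff : z = y by lra.
by apply: h (deep_mem s0 Dz) _ _; lra.
Qed.

Lemma half_depth_exists X : regular X ->
  exists s, 0 < s /\ half_depth X s /\ exists x, deep X s x.
Proof.
move=> /deep_exists[r0 [x0 [r00 [r01 D0]]]].
pose Q := [set r | 0 < r /\ r <= 1 /\ exists x, deep X r x].
have Q0 : Q r0 by split=> //; split=> //; exists x0.
have hQ : has_sup Q by split; [exists r0 | exists 1 => r [_ []]].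
have ubQ : ubound Q (sup Q) := ub_le_sup hQ.2.
have r0s := ubQ _ Q0.
have E : sup Q / 2 + sup Q / 2 = sup Q by lra.
exists (sup Q / 2); split; first by lra.
split.
  rewrite /half_depth E; split=> [r x rp r1 D|t tub].
    by apply: ubQ; split=> //; split=> //; exists x.
  by apply: ge_sup; [exists r0 | move=> r [rp [r1 [x D]]]; apply: tub D].
(* Half the supremum is strictly below it, so a scale above the half has a deep point. *)
have e0 : 0 < sup Q / 2 by lra.
have [r [_ [_ [x D]]] rs] := sup_adherent e0 hQ.
by exists x; apply: deep_le D; lra.
Qed.

Lemma half_depth_inj X s t : half_depth X s -> half_depth X t -> s = t.
Proof. by move=> [s1 s2] [t1 t2]; move: (s2 _ t1) (t2 _ s1); lra. Qed.

Lemma chosen_exists X : regular X -> chosen X !=set0.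
Proof.
move=> /half_depth_exists[s [s0 [hs [x Dx]]]].
have cl := deep_closed (X := X) s0.
have [[z [Dz z1]]|no] := pselect (exists z, deep X s z /\ 1 <= z).
  have [|m [Dm [m1 mmin]]] := closed_min (a := 1) cl; first by exists z.
  by exists m, s; split=> //; split=> //; left.
have lt1 z : deep X s z -> z < 1.
  by move=> Dz; rewrite ltNge; apply/negP => z1; apply: no; exists z.
have [|m [Dm [m1 mmax]]] := closed_max (b := 1) cl.
  by exists x; split=> //; rewrite ltW ?lt1.
exists m, s; split=> //; split=> //; right; split; first exact: lt1.
by move=> z Dz; split; [apply: lt1 | apply: mmax => //; rewrite ltW ?lt1].
Qed.

Lemma chosen_inj X y z : chosen X y -> chosen X z -> y = z.
Proof.
move=> [s [hs [Dy Cy]]] [t [/(half_depth_inj hs)<- [Dz Cz]]].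
case: Cy Cz => [[y1 Cy]|[y1 Cy]] [[z1 Cz]|[z1 Cz]].
- by move: (Cy _ Dz z1) (Cz _ Dy y1); lra.
- by case: (Cz _ Dy); lra.
- by case: (Cy _ Dz); lra.
- by case: (Cy _ Dz) => _; case: (Cz _ Dy) => _; lra.
Qed.

Lemma choose_ptP X y : regular X -> y = choose_pt X <-> chosen X y.
Proof.
move=> /chosen_exists[z Cz]; rewrite /choose_pt.
case: xgetP => [w _ Cw|/(_ z)//].
by split=> [->//|Cy]; apply: chosen_inj Cy Cw.
Qed.

Lemma choose_pt_mem X : regular X -> X (choose_pt X).
Proof.
move=> reg; have /(choose_ptP _ reg)[s [hs [D _]]] := erefl (choose_pt X).
(* [half_depth] does not state positivity of [s]; uniqueness transfers it from the scale just
   constructed. *)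
have [t [t0 [ht _]]] := half_depth_exists reg.
by apply: deep_mem D; rewrite (half_depth_inj hs ht).
Qed.

End Selection.

(** * Definability *)

Section Renaming.
Context {L : language} {M : Type} (S : structure L M).

Fixpoint ren_term n m (f : 'I_n -> 'I_m) (t : term L n) : term L m :=
  match t with
  | Var i => Var L (f i)
  | Defs.Fun _ g args => Defs.Fun g (fun i => ren_term f (args i))
  end.

Definition lift_ren n m (f : 'I_n -> 'I_m) (i : 'I_n.+1) : 'I_m.+1 :=
  if unlift ord0 i is Some j then lift ord0 (f j) else ord0.

Fixpoint ren n (phi : formula L n) : forall m, ('I_n -> 'I_m) -> formula L m :=
  match phi with
  | Eq _ t u => fun m f => Eq (ren_term f t) (ren_term f u)
  | Rel _ _ r args => fun m f => Rel r (fun i => ren_term f (args i))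
  | Not _ psi => fun m f => Not (ren psi f)
  | And _ psi chi => fun m f => And (ren psi f) (ren chi f)
  | Ex _ psi => fun m f => Ex (ren psi (lift_ren f))
  end.

Lemma eval_ren n m (f : 'I_n -> 'I_m) (t : term L n) (v : m.-tuple M) :
  Defs.eval S v (ren_term f t) = Defs.eval S [tuple tnth v (f i) | i < n] t.
Proof.
elim: t => [i|k g args IH] /=; first by rewrite tnth_mktuple.
by congr (fint _ _ _); apply: eq_mktuple => i; rewrite IH.
Qed.

Lemma sat_ren n (phi : formula L n) m (f : 'I_n -> 'I_m) (v : m.-tuple M) :
  sat S (ren phi f) v <-> sat S phi [tuple tnth v (f i) | i < n].
Proof.
elim: phi m f v => {n} /= [n t u|n k r args|n psi IH|n psi IH1 chi IH2|n psi IH]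
  m f v.
- by rewrite !eval_ren.
- suff -> : [tuple Defs.eval S v (ren_term f (args i)) | i < k] =
    [tuple Defs.eval S [tuple tnth v (f i) | i < n] (args i) | i < k] by [].
  by apply: eq_mktuple => i; rewrite eval_ren.
- by rewrite IH.
- by rewrite IH1 IH2.
- have E x : [tuple tnth (cons_tuple x v) (lift_ren f i) | i < n.+1] =
    cons_tuple x [tuple tnth v (f i) | i < n].
    apply: eq_from_tnth => i; rewrite tnth_mktuple /lift_ren.
    case: unliftP => [j ->|->]; last by rewrite !tnth0.
    by rewrite !tnthS tnth_mktuple.
  by split=> -[x]; [rewrite IH E|rewrite -E -IH]; exists x.
Qed.

End Renaming.

Section Definability.
Context {R : realType} {L : language} {S : structure L R}.
Implicit Types (e : nat -> R) (P Q : (nat -> R) -> Prop).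
Implicit Types (s t : (nat -> R) -> R).

(* Predicates on environments: a formula sees an initial segment of [e], and
   quantifiers bind [e 0], which turns a family [X e] of subsets of the line
   into the predicate [X (fun i => e i.+1) (e 0)]. *)
Definition dfn P := exists n (phi : formula L n),
  forall e, sat S phi [tuple e i | i < n] <-> P e.

Definition dterm t := exists n (u : term L n),
  forall e, Defs.eval S [tuple e i | i < n] u = t e.

Lemma dfn_iff P Q : (forall e, P e <-> Q e) -> dfn P -> dfn Q.
Proof. by move=> PQ [n [phi h]]; exists n, phi => e; rewrite h. Qed.

Lemma dfn_ren (f : nat -> nat) P : dfn P -> dfn (fun e => P (fun i => e (f i))).
Proof.
move=> [n [phi h]]; pose m := (\max_(i < n) (f i).+1)%N.
have fm (i : 'I_n) : (f i < m)%N.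
  exact: (leq_bigmax (F := fun j : 'I_n => (f j).+1) i).
exists m, (ren phi (fun i => Ordinal (fm i))) => e; rewrite sat_ren -h.
suff -> : [tuple tnth [tuple e i | i < m] (Ordinal (fm i)) | i < n] =
  [tuple e (f i) | i < n] by [].
by apply: eq_mktuple => i; rewrite tnth_mktuple.
Qed.

(** Brings formulas to a common number of variables before they are combined. *)
Lemma dfn_widen P : dfn P -> exists n, forall m, (n <= m)%N ->
  exists phi : formula L m, forall e, sat S phi [tuple e i | i < m] <-> P e.
Proof.
move=> [n [phi h]]; exists n => m nm; exists (ren phi (widen_ord nm)) => e.
rewrite sat_ren -h.
suff -> : [tuple tnth [tuple e i | i < m] (widen_ord nm i) | i < n] =
  [tuple e i | i < n] by [].
by apply: eq_mktuple => i; rewrite tnth_mktuple.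
Qed.

Lemma dterm_widen t : dterm t -> exists n, forall m, (n <= m)%N ->
  exists u : term L m, forall e, Defs.eval S [tuple e i | i < m] u = t e.
Proof.
move=> [n [u h]]; exists n => m nm; exists (ren_term (widen_ord nm) u) => e.
rewrite eval_ren -h; congr (Defs.eval S _ _).
by apply: eq_mktuple => i; rewrite tnth_mktuple.
Qed.

Lemma dfn_not P : dfn P -> dfn (fun e => ~ P e).
Proof. by move=> [n [phi h]]; exists n, (Not phi) => e /=; rewrite h. Qed.

Lemma dfn_and P Q : dfn P -> dfn Q -> dfn (fun e => P e /\ Q e).
Proof.
move=> /dfn_widen[n1 h1] /dfn_widen[n2 h2].
have [phi1 {}h1] := h1 _ (leq_maxl n1 n2).
have [phi2 {}h2] := h2 _ (leq_maxr n1 n2).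
by exists (maxn n1 n2), (And phi1 phi2) => e /=; rewrite h1 h2.
Qed.

Lemma mktuple_scons n x (e : nat -> R) :
  [tuple scons x e i | i < n.+1] = cons_tuple x [tuple e i | i < n].
Proof.
apply: eq_from_tnth => i; rewrite tnth_mktuple.
by have [j ->|->] := unliftP ord0 i; rewrite ?tnthS ?tnth0 ?tnth_mktuple.
Qed.

Lemma dfn_ex (P : (nat -> R) -> R -> Prop) :
  dfn (fun e => P (fun i => e i.+1) (e 0%N)) ->
  dfn (fun e => exists x, P e x).
Proof.
move=> /dfn_widen[n /(_ _ (leqnSn n))[phi h]]; exists n, (Ex phi) => e /=.
by split=> -[x Px]; exists x; move: Px; rewrite -mktuple_scons h.
Qed.

Lemma dfn_imp P Q : dfn P -> dfn Q -> dfn (fun e => P e -> Q e).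
Proof.
move=> dP dQ; apply: dfn_iff (dfn_not (dfn_and dP (dfn_not dQ))) => e.
by split=> [h p|h [p /(_ (h p))//]]; apply: contrapT => q; apply: h.
Qed.

Lemma dfn_or P Q : dfn P -> dfn Q -> dfn (fun e => P e \/ Q e).
Proof.
move=> dP dQ; apply: dfn_iff (dfn_imp (dfn_not dP) dQ) => e.
by split=> [h|[|] //]; case: (pselect (P e)) => [|/h]; [left|right].
Qed.

Lemma dfn_all (P : (nat -> R) -> R -> Prop) :
  dfn (fun e => P (fun i => e i.+1) (e 0%N)) ->
  dfn (fun e => forall x, P e x).
Proof.
move=> dP; apply: dfn_iff (dfn_not (dfn_ex (P := fun e x => ~ P e x) _)).
  by move=> e; split=> [h x|h [x]]; [apply: contrapT => n; apply: h; exists x|].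
exact: dfn_not.
Qed.

Lemma dterm_var i : dterm (fun e => e i).
Proof. by exists i.+1, (Var L ord_max) => e /=; rewrite tnth_mktuple. Qed.

Lemma dfn_eq s t : dterm s -> dterm t -> dfn (fun e => s e = t e).
Proof.
move=> /dterm_widen[n1 h1] /dterm_widen[n2 h2].
have [u1 {}h1] := h1 _ (leq_maxl n1 n2).
have [u2 {}h2] := h2 _ (leq_maxr n1 n2).
by exists (maxn n1 n2), (Eq u1 u2) => e /=; rewrite h1 h2.
Qed.

(** Moves entry 0 behind the other variables, the order in which [definable] expects parameters and
    point. *)
Lemma dfn_params P : dfn P -> exists n (phi : formula L (n + 1)), forall e x,
  sat S phi (cat_tuple [tuple e i | i < n] [tuple x]) <-> P (scons x e).
Proof.
move=> /dfn_widen[n /(_ _ (leqnSn n))[phi h]].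
exists n, (ren phi (fun i : 'I_n.+1 =>
  if unlift ord0 i is Some j then lshift 1 j else rshift n ord0)) => e x.
rewrite sat_ren -h.
match goal with |- sat _ _ ?v <-> sat _ _ ?w => suff -> : v = w by [] end.
apply: eq_mktuple => i; have [j ->|->] := unliftP ord0 i.
  by rewrite tnth_lshift tnth_mktuple.
by rewrite tnth_rshift.
Qed.

(** All variables beyond [k] are sent to a single quantified one, which plays the default value of
    [nth]. *)
Lemma dfn_arity P k : dfn P -> exists phi : formula L k,
  forall v : k.-tuple R, sat S phi v <-> exists x, P (nth x v).
Proof.
move=> [n [phi h]].
exists (Ex (ren phi (fun i : 'I_n =>
  if insub (val i) is Some j then lift (@ord0 k) j else ord0))) => v /=.
suff E x : sat S (ren phi (fun i : 'I_n =>
    if insub (val i) is Some j then lift (@ord0 k) j else ord0))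
    (cons_tuple x v) <-> P (nth x v).
  by split=> -[x]; [rewrite E|rewrite -E]; exists x.
rewrite sat_ren -h.
match goal with |- sat _ _ ?v <-> sat _ _ ?w => suff -> : v = w by [] end.
apply: eq_mktuple => i; case: insubP => [j _ <-|].
  by rewrite tnthS (tnth_nth x).
by rewrite -leqNgt => ki; rewrite tnth0 nth_default // size_tuple.
Qed.

(** * Definability over the ordered group *)

Hypothesis S_expands : expands (real_og R) S.

Lemma dterm_one : dterm (fun=> 1).
Proof.
have [fi [ri [hf _]]] := S_expands.
exists 0%N, (Defs.Fun (fi 0%N og_one) (fun i => Var L i)) => e /=.
by rewrite hf.
Qed.

Lemma dterm_add s t : dterm s -> dterm t -> dterm (fun e => s e + t e).
Proof.
have [fi [ri [hf _]]] := S_expands.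
move=> /dterm_widen[n1 h1] /dterm_widen[n2 h2].
have [u1 {}h1] := h1 _ (leq_maxl n1 n2).
have [u2 {}h2] := h2 _ (leq_maxr n1 n2).
exists (maxn n1 n2), (Defs.Fun (fi 2%N og_add)
  (fun i => if i == ord0 then u1 else u2)) => e /=.
by rewrite hf /= !tnth_mktuple /= h1 h2.
Qed.

Lemma dfn_lt s t : dterm s -> dterm t -> dfn (fun e => s e < t e).
Proof.
have [fi [ri [_ hr]]] := S_expands.
move=> /dterm_widen[n1 h1] /dterm_widen[n2 h2].
have [u1 {}h1] := h1 _ (leq_maxl n1 n2).
have [u2 {}h2] := h2 _ (leq_maxr n1 n2).
exists (maxn n1 n2), (Rel (ri 2%N og_lt)
  (fun i => if i == ord0 then u1 else u2)) => e /=.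
by rewrite hr /= !tnth_mktuple /= h1 h2.
Qed.

Lemma dfn_le s t : dterm s -> dterm t -> dfn (fun e => s e <= t e).
Proof.
move=> ds dt; apply: dfn_iff (dfn_not (dfn_lt dt ds)) => e.
by rewrite leNgt; split=> /negP.
Qed.

(** The language has no symbol for 0, so positivity is expressed as [t < t + t]. *)
Lemma dfn_pos t : dterm t -> dfn (fun e => 0 < t e).
Proof.
move=> dt; apply: dfn_iff (dfn_lt dt (dterm_add dt dt)) => e.
by rewrite ltrDl.
Qed.

(** Under several quantifiers the parameters of the family start at position [k] and the tested
    point sits at position [j]. *)
Lemma dfn_fam (X : (nat -> R) -> set R) k j :
  dfn (fun e => X (fun i => e i.+1) (e 0%N)) ->
  dfn (fun e => X (fun i => e (k + i)%N) (e j)).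
Proof. exact: (dfn_ren (fun i => if i is i'.+1 then (k + i')%N else j)). Qed.

(* Finds the renaming by trying all shifts up to [k] and indices up to 9. *)
Ltac prove_fam hX k j :=
  first [ exact: (dfn_fam k j hX)
        | lazymatch j with
          | ?j'.+1 => prove_fam hX k j'
          | O => lazymatch k with ?k'.+1 => prove_fam hX k' 9%N end
          end ].

Ltac prove_dterm :=
  first [ exact: dterm_one
        | exact: dterm_var
        | apply: dterm_add; prove_dterm ].

Ltac prove_dfn hX :=
  cbv beta;
  first [ prove_fam hX 9%N 9%N
        | apply: dfn_not; prove_dfn hX
        | apply: dfn_and; prove_dfn hX
        | apply: dfn_or; prove_dfn hX
        | apply: dfn_ex; prove_dfn hX
        | apply: dfn_imp; prove_dfn hX
        | apply: dfn_all; prove_dfn hX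
        | apply: dfn_pos; prove_dterm
        | apply: dfn_lt; prove_dterm
        | apply: dfn_le; prove_dterm
        | apply: dfn_eq; prove_dterm ].

Lemma chosen_dfn (X : (nat -> R) -> set R) :
  dfn (fun e => X (fun i => e i.+1) (e 0%N)) ->
  dfn (fun e => chosen (X (fun i => e i.+1)) (e 0%N)).
Proof.
by move=> hX; rewrite /chosen /half_depth /deep /isolated /has_interior;
  prove_dfn hX.
Qed.

(** * Nonempty definable sets are regular *)

Lemma gap_between_dfn (X : (nat -> R) -> set R) :
  dfn (fun e => X (fun i => e i.+1) (e 0%N)) ->
  dfn (fun e => gap_between (X (fun i => e i.+3)) (e 2%N) (e 1%N) (e 0%N)).
Proof. by move=> hX; rewrite /gap_between /nogap /gap; prove_dfn hX. Qed.

(* The topological closure, in first-order form. *)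
Definition closure_pts (X : set R) : set R :=
  [set x | forall a b, a < x -> x < b -> exists z, X z /\ a < z /\ z < b].

Lemma closure_pts_closed (X : set R) : limit_closed (closure_pts X).
Proof.
move=> x xcl a b ax xb; have [y [ycl [ay yb]]] := xcl a b ax xb.
exact: ycl.
Qed.

(** If [x] were the only point of the closure in [(a, b)], it would belong to [X] and be isolated in
    it. *)
Lemma closure_pts_dense_in_itself (X : set R) :
  ~ (exists x r, 0 < r /\ isolated X r x) -> dense_in_itself (closure_pts X).
Proof.
move=> niso x a b xcl ax xb.
have sub z : X z -> closure_pts X z by move=> Xz u v ? ?; exists z.
have [z [Xz [az zb]]] := xcl a b ax xb.
have [zx|] := pselect (z = x); last by exists z; split=> //; apply: sub.
have : ~ isolated X (Num.min (x - a) (b - x)) x.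
  move=> iso; apply: niso; exists x, (Num.min (x - a) (b - x)); split=> //.
  by rewrite lt_min; apply/andP; split; lra.
apply: contra_notP => no; split=> [|w Xw]; first by rewrite -zx.
move=> xw wx; apply: contrapT => wnx; apply: no; exists w.
split; first exact: sub.
have rl : Num.min (x - a) (b - x) <= x - a by rewrite ge_min lexx.
have rr : Num.min (x - a) (b - x) <= b - x by rewrite ge_min lexx orbT.
by split=> //; split; lra.
Qed.

(** Either [X e] misses a subinterval of [(a, b)], whose midpoint then avoids the closure, or it is
    dense in [(a, b)]; having no interior it is also co-dense there, against noiselessness. *)
Lemma noiseless_nowhere_dense (X : (nat -> R) -> set R) e :
  noiseless S -> dfn (fun e => X (fun i => e i.+1) (e 0%N)) ->
  ~ has_interior (X e) -> empty_interior (closure_pts (X e)).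
Proof.
move=> nS hX nint a b ab.
have [[a' [b' [a'b' [aa' [b'b h]]]]]|dense] := pselect (exists a' b', a' < b' /\
    a <= a' /\ b' <= b /\ ~ exists z, X e z /\ a' < z /\ z < b').
  exists ((a' + b') / 2); split; last by split; lra.
  by move=> /(_ a' b')[||z]; [lra|lra|move=> hz; apply: h; exists z].
case: nS; exists (X e); split.
  have [n [phi hphi]] := dfn_params hX.
  exists n, [tuple e i | i < n], phi; apply/seteqP.
  by split=> v; case/tupleP: v => x v; rewrite tuple0 /= hphi.
exists a, b; split=> //; split=> x; rewrite /= in_itv /= => /andP[ax xb] B
    /nbhs_ballP[r /= r0 rB].
  have lt_ab : Num.max a (x - r) < Num.min b (x + r).
    by rewrite lt_min !gt_max; do !(apply/andP; split); lra.
  have {dense}[z [Xz [lz zr]]] : exists z, X e z /\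
      Num.max a (x - r) < z /\ z < Num.min b (x + r).
    apply: contrapT => no; apply: dense.
    exists (Num.max a (x - r)), (Num.min b (x + r)).
    by rewrite le_max ge_min !lexx.
  move: lz zr; rewrite gt_max lt_min => /andP[az xz] /andP[zb zx].
  exists z; split; first by split=> //=; rewrite in_itv /= az.
  by apply: rB; rewrite /ball /= ltr_distlC; apply/andP; split; lra.
have lt_ab : Num.max a (x - r) < Num.min b (x + r).
  by rewrite lt_min !gt_max; do !(apply/andP; split); lra.
apply: contrapT => no; apply: nint.
exists (Num.max a (x - r)), (Num.min b (x + r)); split=> //.
move=> z; rewrite gt_max lt_min => /andP[az xz] /andP[zb zx].
apply: contrapT => nXz; apply: no; exists z.
split; first by split=> //=; rewrite in_itv /= az.
by apply: rB; rewrite /ball /= ltr_distlC; apply/andP; split; lra.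
Qed.

Lemma definable_regular (X : (nat -> R) -> set R) e :
  noiseless S -> NIP S -> dfn (fun e => X (fun i => e i.+1) (e 0%N)) ->
  X e !=set0 -> regular (X e).
Proof.
move=> nS NS hX X0; split=> //; apply: contrapT => /not_orP[nint niso].
have hC : dfn (fun e => closure_pts (X (fun i => e i.+1)) (e 0%N)).
  by rewrite /closure_pts /mkset; prove_dfn hX.
have [n [phi hphi]] :=
  dfn_params (gap_between_dfn (X := fun e => closure_pts (X e)) hC).
apply: (NS _ _ phi) => k.
have C0 : closure_pts (X e) !=set0.
  by have [x Xx] := X0; exists x => a b ax xb; exists x.
have [d [c dc]] := gap_shatter k (@closure_pts_closed (X e))
  (noiseless_nowhere_dense nS hX nint) (closure_pts_dense_in_itself niso) C0.
(* The index [i] is coded by the scales [d i] and [d i.+1], followed by the fixed parameters [e];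
   the subset [I] is coded by the point [c I]. *)
exists (fun i => [tuple scons (d i) (scons (d i.+1) e) j | j < n]).
by exists (fun I => [tuple c I]) => i I; rewrite hphi -dc.
Qed.

(** * Choice of tuples, coordinate by coordinate *)

(** The first [n] entries of the environment are the point, the remaining ones the parameters. *)
Definition dfn_family n (B : (nat -> R) -> set (n.-tuple R)) :=
  dfn (fun e => B (fun i => e (n + i)%N) [tuple e i | i < n]).

Lemma mktuple_cons n (f : nat -> R) :
  [tuple f i | i < n.+1] = cons_tuple (f 0%N) [tuple f i.+1 | i < n].
Proof.
apply: eq_from_tnth => i; rewrite tnth_mktuple.
have [j ->|->] := unliftP ord0 i; last by rewrite tnth0.
by rewrite tnthS tnth_mktuple lift0.
Qed.

Lemma exists_tupleS n (P : n.+1.-tuple R -> Prop) :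
  (exists v, P v) <-> exists x v, P (cons_tuple x v).
Proof.
split=> [[v]|[x [v Pv]]]; last by exists (cons_tuple x v).
case/tupleP: v => x v Pv; exists x, v.
by move: Pv; congr P; apply: val_inj.
Qed.

Lemma dfn_family_cons n (B : (nat -> R) -> set (n.+1.-tuple R)) :
  dfn_family B ->
  dfn_family (fun e => [set y | B (fun i => e i.+1) (cons_tuple (e 0%N) y)]).
Proof.
(* The first coordinate becomes a parameter, so it moves from position 0 to position [n], behind the
   other coordinates. *)
pose f i := if i is i'.+1 then if (i' < n)%N then i' else i else n.
move=> /(dfn_ren f); apply: dfn_iff => e.
rewrite (mktuple_cons n (fun i => e (f i))) addn0 /=.
have -> : (fun i => e (f (n.+1 + i)%N)) = (fun i => e (n + i.+1)%N).
  by apply: funext => i; rewrite /f /= ltnNge leq_addr addnS.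
suff -> : [tuple e (f i.+1) | i < n] = [tuple e i | i < n] by [].
by apply: eq_mktuple => i; rewrite /f ltn_ord.
Qed.

Lemma dfn_exists_tuple n (B : (nat -> R) -> set (n.-tuple R)) :
  dfn_family B -> dfn (fun e => exists y, B e y).
Proof.
elim: n B => [|n IH] B dB.
  apply: dfn_iff dB => e; rewrite (tuple0 [tuple e i | i < 0]).
  by split=> [h|[y]]; [exists [tuple]|rewrite (tuple0 y)].
apply: (dfn_iff (fun e => iff_sym (exists_tupleS (B e)))).
by apply: dfn_ex; apply: IH; apply: dfn_family_cons.
Qed.

Definition fst_coord n (B : set (n.+1.-tuple R)) : set R :=
  [set x | exists y, B (cons_tuple x y)].

Fixpoint choose_tuple n : set (n.-tuple R) -> n.-tuple R :=
  match n with
  | 0 => fun=> [tuple]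
  | _.+1 => fun B =>
      let x := choose_pt (fst_coord B) in
      cons_tuple x (choose_tuple [set y | B (cons_tuple x y)])
  end.

Lemma fst_coord_dfn n (B : (nat -> R) -> set (n.+1.-tuple R)) :
  dfn_family B -> dfn (fun e => fst_coord (B (fun i => e i.+1)) (e 0%N)).
Proof. by move=> dB; apply: dfn_exists_tuple; apply: dfn_family_cons. Qed.

Lemma fst_coord_nonempty n (B : set (n.+1.-tuple R)) :
  B !=set0 -> fst_coord B !=set0.
Proof. by move=> [v Bv]; apply/exists_tupleS; exists v. Qed.

Section Uniformization.
Hypothesis S_noiseless : noiseless S.
Hypothesis S_NIP : NIP S.

Lemma choose_tuple_mem n (B : (nat -> R) -> set (n.-tuple R)) e :
  dfn_family B -> B e !=set0 -> B e (choose_tuple (B e)).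
Proof.
elim: n B e => [|n IH] B e dB B0; first by have [v] := B0; rewrite (tuple0 v).
have [y By] : fst_coord (B e) (choose_pt (fst_coord (B e))).
  apply: choose_pt_mem.
  exact: (definable_regular (X := fun e => fst_coord (B e)) S_noiseless S_NIP
    (fst_coord_dfn dB) (fst_coord_nonempty B0)).
have dB' := dfn_family_cons dB.
by have := IH _ (scons (choose_pt (fst_coord (B e))) e) dB'; apply; exists y.
Qed.

(** The first coordinate is given by [chosen], the others by induction in the fibre over it. The
    graph is restricted to nonempty fibres, where regularity makes [chosen] describe [choose_pt]. *)
Lemma choose_tuple_dfn n (B : (nat -> R) -> set (n.-tuple R)) :
  dfn_family B ->
  dfn_family (fun e => [set y | B e !=set0 /\ y = choose_tuple (B e)]).
Proof.
elim: n B => [|n IH] B dB.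
  apply: dfn_iff dB => e /=; rewrite (tuple0 [tuple e i | i < 0]).
  by split=> [h|[[y]]]; [split=> //; exists [tuple]|rewrite (tuple0 y)].
have dF := fst_coord_dfn dB.
(* [f] keeps the first coordinate and skips the other [n] to reach the parameters; [g] puts the
   first coordinate behind the others, as the induction hypothesis expects. *)
pose f i := if i is i'.+1 then (n.+1 + i')%N else 0%N.
pose g i := if (i < n)%N then i.+1 else if i == n then 0%N else i.
have h2 := dfn_ren f (dfn_and dF
  (chosen_dfn (X := fun e => fst_coord (B e)) dF)).
have h1 := dfn_ren g (IH _ (dfn_family_cons dB)).
apply: dfn_iff (dfn_and h2 h1) => e /=.
have -> : [tuple e (g i) | i < n] = [tuple e i.+1 | i < n].
  by apply: eq_mktuple => i; rewrite /g ltn_ord.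
have -> : (fun i => e (g (n + i.+1)%N)) = (fun i => e (n.+1 + i)%N).
  apply: funext => i; rewrite /g ltnNge leq_addr /= -{2}(addn0 n) eqn_add2l /=.
  by rewrite addSnnS.
have -> : g (n + 0)%N = 0%N by rewrite /g addn0 ltnn eqxx.
rewrite (mktuple_cons n e).
set e' := (fun i => e (n.+1 + i)%N); set y := [tuple e i.+1 | i < n].
have regF : fst_coord (B e') !=set0 -> regular (fst_coord (B e')).
  exact: (definable_regular (X := fun e => fst_coord (B e))).
split.
  move=> [[F0 C] [_ ->]].
  have reg := regF (ex_intro _ _ F0).
  split; first by have [v Bv] := F0; exists (cons_tuple (e 0%N) v).
  by move/(choose_ptP _ reg): C => ->.
move=> [B0 /(congr1 val)[E1 E2]].
have reg := regF (fst_coord_nonempty B0).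
have Ey : y = choose_tuple
    [set y0 | B e' (cons_tuple (choose_pt (fst_coord (B e'))) y0)].
  exact: val_inj.
have F0 := choose_pt_mem reg.
by rewrite E1; split; [split=> //; apply/choose_ptP | split].
Qed.

End Uniformization.

End Definability.

(** * The choice function on the projection *)

Lemma cat_tuple_inj (T : eqType) m n (a a' : m.-tuple T) (y y' : n.-tuple T) :
  cat_tuple a y = cat_tuple a' y' -> a = a' /\ y = y'.
Proof.
move=> /(congr1 val)/eqP; rewrite /= eqseq_cat ?size_tuple //.
by move=> /andP[/eqP E1 /eqP E2]; split; apply: val_inj.
Qed.

Lemma mktuple_cat (T : Type) m n (f : nat -> T) :
  [tuple f i | i < m + n] =
  cat_tuple [tuple f i | i < m] [tuple f (m + i)%N | i < n].
Proof.
apply: eq_from_tnth => i; rewrite tnth_mktuple.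
by have [j ->|j ->] := split_ordP i;
  rewrite ?tnth_lshift ?tnth_rshift tnth_mktuple.
Qed.

Lemma mktuple_nth (T : Type) n (x : T) (v : n.-tuple T) :
  [tuple nth x v i | i < n] = v.
Proof.
by apply: eq_from_tnth => i; rewrite tnth_mktuple (tnth_nth x).
Qed.

Lemma prod_setE (R : realType) m n (A : set (m.-tuple R * n.-tuple R)) a y :
  prod_set A (cat_tuple a y) <-> A (a, y).
Proof.
split=> [[[a' y'] Aay /cat_tuple_inj[<- <-]]//|Aay].
by exists (a, y).
Qed.

Theorem theoremE (R : realType) (L : language) (S : structure L R)
    (S_expands : expands (real_og R) S)
    (S_noiseless : noiseless S) (S_NIP : NIP S)
    (m n : nat) (A : set (m.-tuple R * n.-tuple R))
    (A_def : definable0 S (prod_set A)) :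
  exists f : m.-tuple R -> n.-tuple R,
    definable0_fun S (fst @` A) f /\
    graph_on (fst @` A) f `<=` A /\
    (forall a b : m.-tuple R, (fst @` A) a -> (fst @` A) b ->
       xsection A a = xsection A b -> f a = f b).
Proof.
pose B (e : nat -> R) := xsection A [tuple e i | i < m].
have xsecE a y : xsection A a y <-> A (a, y).
  by rewrite /xsection /= in_setE.
have projE a : (fst @` A) a <-> xsection A a !=set0.
  split=> [[[a' y] Aay <-]|[y /xsecE Aay]]; last by exists (a, y).
  by exists y; apply/xsecE.
have dB : @dfn_family R L S n B.
  have [phi hphi] := A_def.
  have dA : @dfn R L S (fun e => sat S phi [tuple e i | i < m + n]).
    by exists (m + n)%N, phi.
  (* The formula for [A] reads the base point first, whereas [dfn_family] puts the fibre point
     first; [g] swaps the two blocks. *)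
  pose g i := if (i < m)%N then (n + i)%N else (i - m)%N.
  apply: dfn_iff (dfn_ren g dA) => e.
  have -> : sat S phi [tuple e (g i) | i < m + n] =
      prod_set A [tuple e (g i) | i < m + n] by rewrite hphi.
  rewrite (mktuple_cat m n (fun i => e (g i))) prod_setE /B xsecE.
  have -> : [tuple e (g i) | i < m] = [tuple e (n + i)%N | i < m].
    by apply: eq_mktuple => i; rewrite /g ltn_ord.
  suff -> : [tuple e (g (m + i)%N) | i < n] = [tuple e i | i < n] by [].
  by apply: eq_mktuple => i; rewrite /g ltnNge leq_addr addKn.
exists (fun a => choose_tuple (xsection A a)); split; last split.
(* The inverse swap of blocks, back to base point first. *)
- pose g i := if (i < n)%N then (m + i)%N else (i - n)%N.
  have [phi hphi] := dfn_arity (m + n)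
    (dfn_ren g (choose_tuple_dfn S_expands S_noiseless S_NIP dB)).
  have {}hphi (a : m.-tuple R) (y : n.-tuple R) : sat S phi (cat_tuple a y) <->
      xsection A a !=set0 /\ y = choose_tuple (xsection A a).
    have E x : [tuple nth x (cat_tuple a y) (g (n + i)%N) | i < m] = a /\
        [tuple nth x (cat_tuple a y) (g i) | i < n] = y.
      have /cat_tuple_inj[E1 E2] : cat_tuple
          [tuple nth x (cat_tuple a y) i | i < m]
          [tuple nth x (cat_tuple a y) (m + i)%N | i < n] = cat_tuple a y.
        by rewrite -(mktuple_cat m n (nth x (cat_tuple a y))) mktuple_nth.
      split; [rewrite -[RHS]E1|rewrite -[RHS]E2]; apply: eq_mktuple => i.
        by rewrite /g ltnNge leq_addr addKn.
      by rewrite /g ltn_ord.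
    rewrite hphi /B /=.
    (* All positions read are below [m + n], so the default of [nth] never matters. *)
    split=> [[x]|h]; last exists 0; first by have [-> ->] := E x.
    by have [-> ->] := E 0.
  exists phi; apply/seteqP; split=> v /=.
    by move=> [[a y] [/= /projE Aa ->] <-]; apply/hphi.
  rewrite -(mktuple_nth 0 v) (mktuple_cat m n) => /hphi[/projE Aa Ey].
  by exists (([tuple nth 0 v i | i < m] : m.-tuple R),
             ([tuple nth 0 v (m + i)%N | i < n] : n.-tuple R)).
- move=> [a y] [/= /projE Aa ->]; apply/xsecE.
  have E : B (nth 0 a) = xsection A a by rewrite /B mktuple_nth.
  have := choose_tuple_mem S_expands S_noiseless S_NIP (e := nth 0 a) dB.
  by rewrite E; apply.
- by move=> a b _ _ ->.
Qed.
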